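(* Let $T$ be a minimal homeomorphism of a compact metric space $X$, let $G$ be a nilpotent locally compact second countable group, let $f\colon X\to G$ be a continuous regular cocycle, let $C\subseteq X\times G$ be a surjective $\mathbf T_f$-orbit closure and $H=\mathrm{Stab}(C)$. Then (1) for every $x\in X$ there is $g_x\in G$ with $C_x=\{g\in G:(x,g)\in C\}=g_xH$; and (2) the map $\gamma\colon X\to G/H$, $\gamma(x)=g_xH$, is continuous.
   Context: The cocycle is $f(n,x)=f(T^{n-1}x)\cdots f(x)$ for $n\ge1$, $f(0,x)=\mathbf 1_G$, $f(n,x)=f(-n,T^nx)^{-1}$ for $n<0$. The skew product is $\mathbf T_f(x,g)=(Tx,f(x)g)$. A surjective $\mathbf T_f$-orbit closure is the closure of the $\mathbf T_f$-orbit of a single point which projects onto all of $X$; $f$ is regular if one exists. $\mathrm{Stab}(C)=\{h\in G:R_h(C)=C\}$ with $R_h(x,g)=(x,gh^{-1})$. *)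

(* Defs.v *)
From HB Require Import structures.
From mathcomp Require Import all_boot all_order all_algebra.
From mathcomp Require Import all_classical all_reals all_analysis.
Set Implicit Arguments. Unset Strict Implicit. Unset Printing Implicit Defensive.
Import Order.TTheory GRing.Theory Num.Theory.
Local Open Scope classical_set_scope.

Definition group_laws (G : Type) (mul : G -> G -> G) (inv : G -> G) (one : G) :=
  [/\ forall a b c, mul a (mul b c) = mul (mul a b) c,
      forall a, mul one a = a, forall a, mul a one = a,
      forall a, mul (inv a) a = one & forall a, mul a (inv a) = one].

Definition topological_group (G : topologicalType)
  (mul : G -> G -> G) (inv : G -> G) (one : G) :=
  [/\ group_laws mul inv one,
      continuous (fun p : G * G => mul p.1 p.2) & continuous inv].

Definition is_subgroup (G : Type) (mul : G -> G -> G) (inv : G -> G) (one : G)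
  (H : set G) :=
  [/\ H one, forall a b, H a -> H b -> H (mul a b) & forall a, H a -> H (inv a)].

Definition gen_subgroup (G : Type) (mul : G -> G -> G) (inv : G -> G) (one : G)
  (S : set G) : set G :=
  \bigcap_(K in [set K | is_subgroup mul inv one K /\ S `<=` K]) K.

Definition commutator (G : Type) (mul : G -> G -> G) (inv : G -> G) (a b : G) :=
  mul (mul (inv a) (inv b)) (mul a b).

Fixpoint lower_central (G : Type) (mul : G -> G -> G) (inv : G -> G) (one : G)
  (n : nat) : set G :=
  match n with
  | 0 => setT
  | n'.+1 => gen_subgroup mul inv one
      [set commutator mul inv a b | a in lower_central mul inv one n' & b in setT]
  end.

Definition nilpotent_group (G : Type) (mul : G -> G -> G) (inv : G -> G) (one : G) :=
  exists n, lower_central mul inv one n = [set one].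

Definition homeomorphism (X : topologicalType) (T Tinv : X -> X) :=
  [/\ cancel T Tinv, cancel Tinv T, continuous T & continuous Tinv].

Definition minimal_map (X : topologicalType) (T : X -> X) :=
  forall A : set X, closed A -> A !=set0 -> T @` A = A -> A = setT.

Definition Tpow (X : Type) (T Tinv : X -> X) (n : int) (x : X) : X :=
  match n with
  | Posz k => iter k T x
  | Negz k => iter k.+1 Tinv x
  end.

Fixpoint cocycle_nat (X G : Type) (mul : G -> G -> G) (one : G) (T : X -> X)
  (f : X -> G) (k : nat) (x : X) : G :=
  match k with
  | 0 => one
  | k'.+1 => mul (f (iter k' T x)) (cocycle_nat mul one T f k' x)
  end.

Definition cocycle (X G : Type) (mul : G -> G -> G) (inv : G -> G) (one : G)
  (T Tinv : X -> X) (f : X -> G) (n : int) (x : X) : G :=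
  match n with
  | Posz k => cocycle_nat mul one T f k x
  | Negz k => inv (cocycle_nat mul one T f k.+1 (Tpow T Tinv n x))
  end.

Definition skew_orbit (X G : Type) (mul : G -> G -> G) (inv : G -> G) (one : G)
  (T Tinv : X -> X) (f : X -> G) (p : X * G) : set (X * G) :=
  [set (Tpow T Tinv n p.1, mul (cocycle mul inv one T Tinv f n p.1) p.2) | n in @setT int].

Definition surj_orbit_closure (X : topologicalType) (G : topologicalType)
  (mul : G -> G -> G) (inv : G -> G) (one : G)
  (T Tinv : X -> X) (f : X -> G) (C : set (X * G)) :=
  exists p : X * G, C = closure (skew_orbit mul inv one T Tinv f p) /\
                    fst @` C = setT.

Definition regular_cocycle (X : topologicalType) (G : topologicalType)
  (mul : G -> G -> G) (inv : G -> G) (one : G)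
  (T Tinv : X -> X) (f : X -> G) :=
  exists C, surj_orbit_closure mul inv one T Tinv f C.

Definition Stab (X G : Type) (mul : G -> G -> G) (inv : G -> G)
  (C : set (X * G)) : set G :=
  [set h | (fun p : X * G => (p.1, mul p.2 (inv h))) @` C = C].

Definition fiber (X G : Type) (C : set (X * G)) (x : X) : set G :=
  [set g | C (x, g)].

Definition lcoset (G : Type) (mul : G -> G -> G) (g : G) (H : set G) : set G :=
  [set mul g h | h in H].

(* G/H represented as the set of left cosets; quotient topology: a family W of
   cosets is open iff the union of its members (its preimage under G -> G/H)
   is open in G.  gamma : X -> G/H is continuous iff preimages of open
   families are open. *)
Definition continuous_to_quotient (X : topologicalType) (G : topologicalType)
  (mul : G -> G -> G) (H : set G) (gamma : X -> set G) :=
  forall W : set (set G),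
    W `<=` [set lcoset mul g H | g in @setT G] ->
    open (\bigcup_(c in W) c) ->
    open (gamma @^-1` W).

(* Main.v *)
Require Import Defs.
From HB Require Import structures.
From mathcomp Require Import all_boot all_order all_algebra.
From mathcomp Require Import all_classical all_reals all_analysis.
Set Implicit Arguments.
Unset Strict Implicit.
Unset Printing Implicit Defensive.
Import Order.TTheory GRing.Theory Num.Theory.
Local Open Scope classical_set_scope.

(** Baire category gives a point [x1] such that all points of [C] above [x1]
   have the same orbit closure [C0], and such that the fibres of [C] near [x1]
   meet a fixed compact set.  With [H0 = Stab C0], the fibre of [C0] above [x1]
   is then a single coset of [H0], and above a neighbourhood of [x1] the set
   [C0] is compact modulo [H0].  If [a] and [b] lie in the fibre of [C0] above
   an arbitrary [x], moving [x] along its orbit to [x1] makes the two points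
   equal modulo [H0], so [H0] meets the closure of [H0 a^-1 b H0]; in a
   nilpotent group this forces [a^-1 b] into [H0], by descending the chain of
   iterated normalizers of [H0].  Thus every fibre of [C0] is a coset of [H0],
   and comparing [C0] with its right translate through the base point of [C]
   gives [C = C0].  Continuity follows from compactness modulo [H]. *)

(** * Baire category and compactness *)

(** Tube lemma: each [k] in [K] has a product neighbourhood that misses [D], and compactness in
    near-covering form makes the neighbourhood of [y0] uniform in [k]. *)
Lemma closed_proj_compact (Y Z : topologicalType) (K : set Z) (D : set (Y * Z)) :
  compact K -> closed D -> closed [set y | exists2 k, K k & D (y, k)].
Proof.
move=> /compact_near_coveringP cK cD; rewrite -openC openE => y0 nD.
rewrite /interior; near=> y; suff KD : K `<=` fun k => ~ D (y, k).
  by move=> [k Kk]; apply: KD.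
near: y; apply: (cK Y (nbhs y0) (fun y k => ~ D (y, k))) => k Kk.
have oD : open (~` D) by rewrite openC.
have : nbhs (y0, k) (~` D).
  by apply: open_nbhs_nbhs; split=> // Dk; apply: nD; exists k.
move=> [[A B] /= [yA kB] AB].
by exists (B, A) => //= -[z y] /= [Bz Ay]; apply: (AB (y, z)).
Unshelve. all: by end_near. Qed.

(** Baire's theorem by shrinking open sets: regularity puts the closure of each inside the previous
    one and off the next [F i]. Compactness then gives a point common to all the closures. *)
Lemma baire_compact_regular (X : topologicalType) (I : countType) (F : I -> set X) :
  compact [set: X] -> regular_space X -> [set: X] !=set0 ->
  (forall i, closed (F i)) -> (forall i, (F i)° = set0) ->
  exists x, forall i, ~ F i x.
Proof.
move=> cX regX X0 cF F0.
have step : forall iU : nat * set X, exists V : set X, open iU.2 -> iU.2 !=set0 ->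
    [/\ open V, V !=set0, closure V `<=` iU.2 &
        forall i, unpickle iU.1 = Some i -> closure V `<=` ~` F i].
  move=> [n U] /=.
  have [[oU [u Uu]]|nU] := pselect (open U /\ U !=set0); last first.
    by exists set0 => oU U0; case: nU.
  (* The empty set is the default when [n] codes no index, so that every stage shrinks in the same
     way. *)
  pose F' := if unpickle n is Some i then F i else set0.
  have cF' : closed F' by rewrite /F'; case: unpickle => // ; exact: closed0.
  have F'0 : F'° = set0 by rewrite /F'; case: unpickle => //; exact: interior0.
  have [y [Uy nFy]] : (U `\` F') !=set0.
    apply: contrapT => /nonemptyPn; rewrite setD_eq0 => UF; suff : F'° u by rewrite F'0.
    by apply: (interiorS UF); rewrite ((interior_id U).1 oU).
  have : nbhs y (U `&` ~` F').
    by apply: open_nbhs_nbhs; split => //; apply: openI => //; rewrite openC.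
  move=> /(regX y) [A yA AU]; exists A°  => _ _; split.
  - exact: open_interior.
  - by exists y.
  - by apply: subset_trans (subset_trans AU _); [apply: closure_subset; exact: interior_subset|move=> z []].
  - move=> i ni; apply: subset_trans (subset_trans AU _).
      by apply: closure_subset; exact: interior_subset.
    by move=> z []; rewrite /F' ni.
have [S SP] := choice step.
pose U := fix U n := if n is m.+1 then S (m, U m) else setT.
have oU : forall n, open (U n) /\ U n !=set0.
  elim=> [|n [oU U0]]; first by split=> //; exact: openT.
  by have [] := SP (n, U n) oU U0.
have US n : [/\ open (U n.+1), U n.+1 !=set0, closure (U n.+1) `<=` U n &
        forall i, unpickle n = Some i -> closure (U n.+1) `<=` ~` F i].
  by have [Uo Un0] := oU n; have := SP (n, U n) Uo Un0.
have Udecr m n : (m <= n)%N -> U n `<=` U m.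
  elim: n => [|n IH]; first by rewrite leqn0 => /eqP ->.
  rewrite leq_eqVlt => /orP[/eqP -> //|mn].
  have [_ _ cU _] := US n.
  by apply: subset_trans (IH mn); apply: subset_trans cU; exact: subset_closure.
have FF : ProperFilter (filter_from [set: nat] U).
  apply: filter_from_proper; last by move=> n _; have [] := oU n.
  apply: filter_from_filter; first by exists 0%N.
  move=> i j _ _; exists (maxn i j) => // x Ux.
  by split; apply: Udecr Ux; rewrite ?leq_maxl ?leq_maxr.
(* A cluster point of the filter generated by the [U n] lies in every [closure (U n)]. *)
have [|x [_ xcl]] := cX _ FF; first by exists 0%N.
exists x => i; have [_ _ _ /(_ i)] := US (pickle i); rewrite pickleK => /(_ erefl) h.
by apply: h => B; apply: (xcl (U (pickle i).+1) B); exists (pickle i).+1.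
Qed.

(** Supplies nowhere dense sets for the Baire argument: a point outside this one that adheres to [P]
    belongs to [P]. *)
Lemma closed_frontier_open {T : topologicalType} (P : set T) :
  open P -> closed (closure P `\` P) /\ (closure P `\` P)° = set0.
Proof.
move=> oP; split.
  by apply: closedI; [exact: closed_closure|rewrite closedC].
rewrite -subset0 => x xi.
have [y [Py /interior_subset [_ nPy]]] : P `&` (closure P `\` P)° !=set0.
  have [cx _] := interior_subset xi; apply: cx.
  by apply: open_nbhs_nbhs; split => //; exact: open_interior.
exact: nPy.
Qed.

(** The companion for closed sets: a point of [A] outside this nowhere dense set is interior to
    [A]. *)
Lemma closed_frontier_closed {T : topologicalType} (A : set T) :
  closed A -> closed (A `\` A°) /\ (A `\` A°)° = set0.
Proof.
move=> cA; split.
  by apply: closedI => //; rewrite closedC; exact: open_interior.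
rewrite -subset0 => x xi.
have [_ ] := interior_subset xi; apply.
by apply: interiorS xi => y [].
Qed.

Lemma second_countable_enum (T : topologicalType) : @second_countable T ->
  exists b : nat -> set T, (forall i, open (b i)) /\
    forall x V, nbhs x V -> exists i, b i x /\ b i `<=` V.
Proof.
move=> [B cB [oB Bx]].
have [B0|[f]] := pfcard_geP cB.
  exists (fun=> set0); split=> [_|x V /Bx[U [BU _]]]; first exact: open0.
  by move: BU; rewrite B0.
exists f; split=> [i|x V /Bx[U [BU Ux] UV]]; first by apply: oB; exact: funS.
by have [i _ fi] := @surj _ _ _ _ f _ BU; exists i; rewrite fi.
Qed.

Lemma locally_compact_nbhs (T : topologicalType) (x : T) (V : set T) :
  hausdorff_space T -> locally_compact [set: T] -> nbhs x V ->
  exists2 W, nbhs x W & compact (closure W) /\ closure W `<=` V.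
Proof.
move=> hT lT xV; have [K] := lT x I; rewrite withinET => xK [cK clK].
have [W xW WVK] := compact_regular hT cK xK (filterI xV xK).
exists W => //; split; last by move=> y /WVK[].
by apply: subclosed_compact cK _; [exact: closed_closure|move=> y /WVK[]].
Qed.

Lemma compact_metric_second_countable (R : realType) (X : metricType R) :
  compact [set: X] -> [set: X] !=set0 -> @second_countable X.
Proof.
move=> cX [x0 _].
(* [X] is repacked as a pointed space with base point [x0]. *)
pose XP : pseudoPMetricType R := HB.pack (X : Type) (PseudoMetric.class X) (isPointed.Build X x0).
exact: (@compact_second_countable R XP).
Qed.

(** * Subgroups of a nilpotent topological group *)

Section TopologicalGroup.
Variables (G : topologicalType) (mul : G -> G -> G) (inv : G -> G) (one : G).
Hypothesis hG : topological_group mul inv one.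
Local Notation "a ** b" := (mul a b) (at level 40, left associativity).

Lemma mgA a b c : a ** (b ** c) = a ** b ** c. Proof. by case: hG => -[]. Qed.
Lemma mg1g a : one ** a = a. Proof. by case: hG => -[]. Qed.
Lemma mgg1 a : a ** one = a. Proof. by case: hG => -[]. Qed.
Lemma mgVg a : inv a ** a = one. Proof. by case: hG => -[]. Qed.
Lemma mggV a : a ** inv a = one. Proof. by case: hG => -[]. Qed.
Lemma mgKg a b : inv a ** (a ** b) = b. Proof. by rewrite mgA mgVg mg1g. Qed.
Lemma mgKVg a b : a ** (inv a ** b) = b. Proof. by rewrite mgA mggV mg1g. Qed.
Lemma mggK a b : b ** a ** inv a = b. Proof. by rewrite -mgA mggV mgg1. Qed.
Lemma mggKV a b : b ** inv a ** a = b. Proof. by rewrite -mgA mgVg mgg1. Qed.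

Lemma mginv_uniq a b : a ** b = one -> b = inv a.
Proof. by move=> ab; rewrite -[b](mgKg a) ab mgg1. Qed.

Lemma mginvK a : inv (inv a) = a.
Proof. by rewrite -(@mginv_uniq (inv a) a) // mgVg. Qed.

Lemma mginvM a b : inv (a ** b) = inv b ** inv a.
Proof. by apply/esym/mginv_uniq; rewrite mgA mggK mggV. Qed.

Lemma mginv1 : inv one = one.
Proof. by rewrite -[RHS](mgVg one) mgg1. Qed.

Lemma continuous_mg (Y : topologicalType) (a b : Y -> G) :
  continuous a -> continuous b -> continuous (fun y => a y ** b y).
Proof.
move=> ca cb y; case: hG => _ cM _.
apply: (@continuous_comp _ _ _ (fun y => (a y, b y)) (fun p => p.1 ** p.2)).
  by apply: cvg_pair; [exact: ca|exact: cb].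
exact: cM.
Qed.

Lemma continuous_mginv (Y : topologicalType) (a : Y -> G) :
  continuous a -> continuous (fun y => inv (a y)).
Proof.
by move=> ca y; case: hG => _ _ cV; apply: continuous_comp; [exact: ca|exact: cV].
Qed.

(** The set is the product [V H], written as a projection along the compact factor [V]. *)
Lemma closed_mul_compact (V H : set G) :
  compact V -> closed H -> closed [set c | exists2 v, V v & H (inv v ** c)].
Proof.
move=> cV cH.
apply: (@closed_proj_compact G G V [set p | H (inv p.2 ** p.1)]) => //.
apply: (@preimage_closed _ _ (fun p : G * G => inv p.2 ** p.1)) => // p _.
by apply: continuous_mg; [apply: continuous_mginv => q; exact: cvg_snd|move=> q; exact: cvg_fst].
Qed.

Lemma gen_subgroup_is_subgroup (S : set G) :
  is_subgroup mul inv one (gen_subgroup mul inv one S).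
Proof.
split.
- by move=> K [[]].
- by move=> a b Sa Sb K KS; have [[_ KM _] _] := KS; apply: KM; [exact: Sa|exact: Sb].
- by move=> a Sa K KS; have [[_ _ KV] _] := KS; apply: KV; exact: Sa.
Qed.

Lemma lower_central_is_subgroup i :
  is_subgroup mul inv one (lower_central mul inv one i).
Proof. by case: i => [|i]; [split|exact: gen_subgroup_is_subgroup]. Qed.

(** Both conjugations are required, which makes stability under inversion immediate. *)
Definition normalizer (H : set G) : set G :=
  [set g | forall h, H h -> H (inv g ** h ** g) /\ H (g ** h ** inv g)].

Lemma normalizer_is_subgroup (H : set G) : is_subgroup mul inv one (normalizer H).
Proof.
split.
- by move=> h Hh; rewrite mginv1 !mgg1 !mg1g.
- move=> a b Na Nb h Hh; rewrite mginvM; split.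
    by have [+ _] := Nb _ (Na _ Hh).1; rewrite !mgA.
  by have [_] := Na _ (Nb _ Hh).2; rewrite !mgA.
- by move=> a Na h /Na[]; rewrite mginvK.
Qed.

Lemma closed_normalizer (H : set G) : closed H -> closed (normalizer H).
Proof.
move=> cH.
have -> : normalizer H = \bigcap_(h in H) ((fun g => inv g ** h ** g) @^-1` H `&`
    (fun g => g ** h ** inv g) @^-1` H) by [].
have cid : continuous (fun g : G => g) by move=> g; exact: cvg_id.
have cst (h : G) : continuous (fun _ : G => h) by move=> g; exact: cvg_cst.
apply: closed_bigI => h _; apply: closedI; apply: preimage_closed => // g _.
  by apply: continuous_mg => //; apply: continuous_mg => //; exact: continuous_mginv.
by apply: continuous_mg; [exact: continuous_mg|exact: continuous_mginv].
Qed.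

(* Induction along the chain of iterated normalizers of [H], which reaches [G]
   because [G] is nilpotent: if [d] normalizes [H], then the double coset
   [H d H = d H] is closed. *)
Lemma nilpotent_double_coset i (H : set G) d :
  is_subgroup mul inv one H -> closed H -> lower_central mul inv one i `<=` H ->
  closure [set h ** d ** l | h in H & l in H] `&` H !=set0 -> H d.
Proof.
elim: i H => [|i IH] H sH cH GH; first by move=> _; exact: GH.
have [H1 HM HV] := sH.
(* For [a] in the [i]-th term and [h] in [H], the commutator of [a] and [h] lies in the next term,
   hence in [H]; so conjugating [h] by [a] stays in [H]. *)
have NG : lower_central mul inv one i `<=` normalizer H.
  have HG a h : lower_central mul inv one i a ->
      H (commutator mul inv a h) by move=> aG; apply: GH => K [_]; apply; exists a => //; exists h.
  move=> a aG h Hh; split.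
    have /HV := HG a h aG; rewrite /commutator !mginvM !mginvK => /(HM _ _ Hh).
    by rewrite !mgA mggV mg1g.
  have [_ _ GV] := lower_central_is_subgroup i.
  have /(fun x => HM _ _ x Hh) := HG _ (inv h) (GV _ aG).
  by rewrite /commutator !mginvK !mgA mggKV.
have HN : H `<=` normalizer H.
  by move=> a Ha h Hh; have HVa := HV _ Ha; split; apply: (HM _ _ (HM _ _ _ _)).
move=> dH.
(* Replacing [H] by its normalizer enlarges the double coset, so the assumption on [d] survives and
   the induction hypothesis applies. *)
have Nd : normalizer H d.
  apply: IH => //; [exact: normalizer_is_subgroup|exact: closed_normalizer|].
  have [z [zcl Hz]] := dH; exists z; split; last exact: HN.
  apply: closure_subset zcl => _ [h Hh [l Hl <-]].
  by exists h; [exact: HN|exists l => //; exact: HN].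
(* This preimage is the closed coset [d H]; it contains [H d H] because [d] normalizes [H]. *)
have cdH : closed ((fun g => inv d ** g) @^-1` H).
  apply: preimage_closed => // g _; apply: continuous_mg => p.
    exact: cvg_cst.
  exact: cvg_id.
have [z [zcl Hz]] := dH.
have /HV : H (inv d ** z).
  apply: cdH; apply: closure_subset zcl => _ [h Hh [l Hl <-]] /=.
  by rewrite !mgA; apply: HM => //; have [] := Nd _ Hh.
by rewrite mginvM mginvK => /(HM _ _ Hz); rewrite mgA mggV mg1g.
Qed.

End TopologicalGroup.

(** * Orbit closures of skew products *)

Section SkewProduct.
Variables (G : topologicalType) (mul : G -> G -> G) (inv : G -> G) (one : G).
Hypothesis hG : topological_group mul inv one.
Variables (X : topologicalType) (t : int -> X -> X) (u : int -> X -> G).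
Hypothesis t0 : forall x, t 0%R x = x.
Hypothesis tD : forall m n x, t (m + n)%R x = t m (t n x).
Hypothesis u0 : forall x, u 0%R x = one.
Hypothesis uD : forall m n x, u (m + n)%R x = mul (u m (t n x)) (u n x).
Hypothesis ct : forall n, continuous (t n).
Hypothesis cu : forall n, continuous (u n).
Hypothesis minX : forall A : set X, closed A -> A !=set0 ->
  (forall n x, A x -> A (t n x)) -> A = setT.
Local Notation "a ** b" := (mul a b) (at level 40, left associativity).

(** The powers of the skew product, treated as an action of [int] so that negative times need no
    separate case. *)
Definition skew_act (n : int) (p : X * G) : X * G := (t n p.1, u n p.1 ** p.2).
Local Notation act := skew_act.
Local Notation orbit p := (range (fun n => act n p)).

Definition skew_invariant (C : set (X * G)) := forall n p, C p -> C (act n p).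

Lemma act0 p : act 0%R p = p.
Proof. by case: p => x g; rewrite /skew_act t0 u0 (mg1g hG). Qed.

Lemma actD m n p : act (m + n)%R p = act m (act n p).
Proof. by rewrite /skew_act /= tD uD (mgA hG). Qed.

Lemma continuous_act n : continuous (act n).
Proof.
move=> p; apply: (@cvg_pair _ _ _ (nbhs p)).
  by apply: (@continuous_comp _ _ _ fst (t n)); [exact: cvg_fst|exact: ct].
apply: (continuous_mg hG) => q; last exact: cvg_snd.
by apply: (@continuous_comp _ _ _ fst (u n)); [exact: cvg_fst|exact: cu].
Qed.

Lemma orbit_closure_invariant p : skew_invariant (closure (orbit p)).
Proof.
move=> n q qcl B /(@continuous_act n q)/qcl[_ [[m _ <-] Bm]].
by exists (act n (act m p)); split => //; exists (n + m)%R => //; rewrite actD.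
Qed.

Lemma orbit_closure_self p : closure (orbit p) p.
Proof. by apply: subset_closure; exists 0%R => //; rewrite act0. Qed.

Lemma orbit_closure_sub (C : set (X * G)) p :
  closed C -> skew_invariant C -> C p -> closure (orbit p) `<=` C.
Proof.
move=> cC iC Cp q qcl; apply: cC; apply: closure_subset qcl => _ [n _ <-].
exact: iC.
Qed.

(** The orbit of [p] visits both neighbourhoods, and the difference of the visiting times carries
    one visit to the other. This is the transitivity needed in the Baire argument. *)
Lemma orbit_closure_transitive p c c' (U U' : set (X * G)) :
  closure (orbit p) c -> closure (orbit p) c' -> nbhs c U -> nbhs c' U' ->
  exists n q, U q /\ U' (act n q).
Proof.
move=> pc pc' /pc[_ [[i _ <-] Ui]] /pc'[_ [[j _ <-] Uj]].
by exists (j - i)%R, (act i p); rewrite -actD subrK.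
Qed.

Lemma closed_rtranslate (C : set (X * G)) k :
  closed C -> closed [set p | C (p.1, p.2 ** k)].
Proof.
move=> cC; apply: (@preimage_closed _ _ (fun p : X * G => (p.1, p.2 ** k))) => // p _.
apply: (@cvg_pair _ _ _ (nbhs p)); first exact: cvg_fst.
by apply: (continuous_mg hG) => q; [exact: cvg_snd|exact: cvg_cst].
Qed.

Lemma invariant_rtranslate (C : set (X * G)) k :
  skew_invariant C -> skew_invariant [set p | C (p.1, p.2 ** k)].
Proof. by move=> iC n p /= /(iC n); rewrite /skew_act /= (mgA hG). Qed.

Lemma stabP (C : set (X * G)) h :
  Stab mul inv C h <-> (forall p, C p <-> C (p.1, p.2 ** h)).
Proof.
have imE : (fun p : X * G => (p.1, p.2 ** inv h)) @` C = [set p | C (p.1, p.2 ** h)].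
  apply/seteqP; split=> [_ [[x g] Cp <-]|[x g] Cp] /=.
    by rewrite (mggKV hG).
  by exists (x, g ** h) => //=; rewrite (mggK hG).
rewrite /Stab /= imE; split=> [CE p|CE]; first by rewrite -[in X in X <-> _]CE.
by apply/seteqP; split => p; apply CE.
Qed.

Lemma stab_is_subgroup (C : set (X * G)) : is_subgroup mul inv one (Stab mul inv C).
Proof.
split.
- by apply/stabP => -[x g]; rewrite /= (mgg1 hG).
- move=> a b /stabP Ca /stabP Cb; apply/stabP => -[x g].
  by rewrite (Ca (x, g)) (Cb (x, g ** a)) /= (mgA hG).
- move=> a /stabP Ca; apply/stabP => -[x g].
  by rewrite [X in _ <-> X](Ca (x, g ** inv a)) /= (mggKV hG).
Qed.

(** Invariance under [h] amounts to translation by [h] and by [inv h] both mapping [C] into itself;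
    each is a closed condition on [h] for every point of [C]. *)
Lemma closed_stab (C : set (X * G)) : closed C -> closed (Stab mul inv C).
Proof.
move=> cC.
have -> : Stab mul inv C = \bigcap_(p in C)
    ((fun h => (p.1, p.2 ** h)) @^-1` C `&` (fun h => (p.1, p.2 ** inv h)) @^-1` C).
  apply/seteqP; split=> [h hC p Cp|h hC].
    have [_ _ /(_ h hC) hC'] := stab_is_subgroup C.
    by move/stabP: hC => hC; move/stabP: hC' => hC'; split; [exact: (hC p).1|exact: (hC' p).1].
  apply/stabP => -[x g]; split=> [/hC[]//|/hC[_ /=]].
  by rewrite (mggK hG).
have cid : continuous (fun g : G => g) by move=> g; exact: cvg_id.
have cr (g : G) : continuous (fun h => g ** h).
  by apply: (continuous_mg hG) => // q; exact: cvg_cst.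
have crV (g : G) : continuous (fun h => g ** inv h).
  by apply: (continuous_mg hG); [move=> q; exact: cvg_cst|exact: (continuous_mginv hG)].
apply: closed_bigI => p _; apply: closedI; apply: preimage_closed => // h _.
  by apply: (@cvg_pair _ _ _ (nbhs h)); [exact: cvg_cst|exact: cr].
by apply: (@cvg_pair _ _ _ (nbhs h)); [exact: cvg_cst|exact: crV].
Qed.

(** * Density of orbits in the base, and generic points *)

(** The points whose orbit misses [U] form a closed invariant set, which is not all of [X] because
    [U] is nonempty. *)
Lemma meets_orbit (U : set X) x : open U -> U !=set0 -> exists n, U (t n x).
Proof.
move=> oU [y Uy]; apply: contrapT => nU.
have : [set x | forall n, ~ U (t n x)] = setT.
  apply: minX.
  - have -> : [set x | forall n, ~ U (t n x)] = \bigcap_n (t n @^-1` (~` U)).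
      by apply/seteqP; split=> z h n; [move=> _; exact: h|exact: h].
    by apply: closed_bigI => n _; apply: preimage_closed; [move=> z _; exact: ct|rewrite closedC].
  - by exists x => n Un; apply: nU; exists n.
  - by move=> n z nUz m; rewrite -tD.
by move/seteqP => [_ /(_ y I 0%R)]; rewrite t0.
Qed.

(** Density in the form that spreads a closed property from one orbit to all of [X]. *)
Lemma closed_orbit_full (A : set X) x : closed A -> (forall n, A (t n x)) -> A = setT.
Proof.
move=> cA Ax; apply: contrapT => AT.
have [y nAy] : ~` A !=set0 by apply/set0P; rewrite -setCT; apply/eqP => /setC_inj.
have [|n] := @meets_orbit (~` A) x _ (ex_intro _ y nAy); first by rewrite openC.
by apply; exact: Ax.
Qed.

(** The point is chosen outside countably many nowhere dense sets. One family gives lower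
    semicontinuity of the fibres at [x]; the other, with transitivity, turns approximate returns
    near [x] into returns of [x] itself. *)
Lemma generic_point (C : set (X * G)) :
  compact [set: X] -> regular_space X -> [set: X] !=set0 ->
  @second_countable X -> hausdorff_space G -> locally_compact [set: G] ->
  @second_countable G -> closed C ->
  (forall c c' U U', C c -> C c' -> nbhs c U -> nbhs c' U' ->
     exists n q, U q /\ U' (act n q)) ->
  exists x,
    (forall g V, C (x, g) -> nbhs g V -> nbhs x [set y | exists2 v, V v & C (y, v)]) /\
    (forall g g', C (x, g) -> C (x, g') -> closure (orbit (x, g)) (x, g')).
Proof.
move=> cX rX X0 /second_countable_enum[bX [obX bXP]] hdG lcG.
move=> /second_countable_enum[bG [obG bGP]] cC trC.
pose A i := [set x | exists2 k, closure (bG i) k & C (x, k)].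
(* Returns to a basic open set of the base whose cocycle value carries some [w] of one basic open
   set of [G] into another. As [w] need not lie in a fibre of [C], the condition is open in [x]. *)
pose P (o : nat * nat * nat) := [set x | bX o.1.1 x /\ exists n, bX o.1.1 (t n x) /\
  exists w, bG o.1.2 w /\ bG o.2 (u n x ** w)].
have oP o : open (P o).
  rewrite openE => x [ox [n [ox' [w [wi jw]]]]].
  have n1 : nbhs x (bX o.1.1) by exact: open_nbhs_nbhs.
  have n2 : nbhs x (t n @^-1` bX o.1.1) by apply: ct; exact: open_nbhs_nbhs.
  have n3 : nbhs x ((fun y => u n y ** w) @^-1` bG o.2).
    have cuw : continuous (fun y => u n y ** w).
      by apply: (continuous_mg hG) => // q; exact: cvg_cst.
    by apply: cuw; exact: open_nbhs_nbhs.
  apply: filterS (filterI n1 (filterI n2 n3)) => y [y1 [y2 y3]].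
  by split => //; exists n; split => //; exists w.
(* The closure of [A i] is taken because [A i] is shown to be closed only when [closure (bG i)] is
   compact. *)
pose F (i : nat + nat * nat * nat) := match i with
  | inl i => closure (A i) `\` (closure (A i))°
  | inr o => closure (P o) `\` P o
  end.
have cF i : closed (F i) /\ (F i)° = set0.
  case: i => [i|o] /=; last exact: closed_frontier_open.
  exact/closed_frontier_closed/closed_closure.
have [||x nFx] := baire_compact_regular (F := F) cX rX X0.
- by move=> i; have [] := cF i.
- by move=> i; have [] := cF i.
exists x; split=> [g V Cxg gV|g g' Cxg Cxg' B].
  have [W gW [cW WV]] := locally_compact_nbhs hdG lcG gV.
  have [i [gi iW]] := bGP _ _ gW.
  have cAi : closed (A i).
    apply: closed_proj_compact => //; apply: subclosed_compact cW _ => //.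
      exact: closed_closure.
    exact: closure_subset.
  have Aix : A i x by exists g => //; exact: subset_closure.
  have : (closure (A i))° x.
    by apply: contrapT => nAi; apply: (nFx (inl i)); split => //; exact: subset_closure.
  rewrite -(closure_id _).1 // => xA; apply: filterS xA => y [k ki Cyk].
  by exists k => //; apply: WV; exact: closure_subset ki.
move=> [[U N] /= [xU gN] UNB].
(* At [(w, u n x ** w)] this map gives [u n x ** g], and at [(g, g')] it gives [g']. So a return
   that carries some [w] near [g] close to [g'] also carries [g] close to [g']. *)
have cmul : continuous (fun p : G * G => p.2 ** inv p.1 ** g).
  apply: (continuous_mg hG) => q; last exact: cvg_cst.
  by apply: (continuous_mg hG) => p; [exact: cvg_snd|apply: (continuous_mginv hG) => r; exact: cvg_fst].
have : nbhs (g, g') ((fun p : G * G => p.2 ** inv p.1 ** g) @^-1` N).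
  by apply: cmul; rewrite /= (mggKV hG).
move=> [[V V'] /= [gV gV'] VN].
have [i [gi iV]] := bGP _ _ gV.
have [j [gj jV']] := bGP _ _ gV'.
have [k [xk kU]] := bXP _ _ xU.
(* Otherwise [x] would lie in the frontier of [P (k, i, j)], since transitivity produces points of
   this set in every neighbourhood of [x]. *)
have Px : P (k, i, j) x.
  apply: contrapT => nP; apply: (nFx (inr (k, i, j))); split => // Q xQ.
  have xQo : nbhs x (Q `&` bX k) by apply: filterI => //; exact: open_nbhs_nbhs.
  have [||n [[y a] /= [[[Qy oy] ia] [[Qny ony] jna]]]] :=
      trC _ _ ((Q `&` bX k) `*` bG i) ((Q `&` bX k) `*` bG j) Cxg Cxg'.
  - by exists (Q `&` bX k, bG i) => //; split => /=; [exact: xQo|exact: open_nbhs_nbhs].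
  - by exists (Q `&` bX k, bG j) => //; split => /=; [exact: xQo|exact: open_nbhs_nbhs].
  by exists y; split => //; split => //; exists n; split => //; exists a.
have [_ [n [nk [w [iw jw]]]]] := Px.
exists (act n (x, g)); split; first by exists n.
apply: UNB; split; first exact: kU.
have := VN (w, u n x ** w) (conj (iV _ iw) (jV' _ jw)).
by rewrite /= (mggK hG).
Qed.

(** * Orbit closures that are compact modulo their stabilizer over an open set *)

Section OrbitClosure.
Variables (x1 : X) (g1 : G) (V : set G) (U : set X).
Let C := closure (orbit (x1, g1)).
Let H := Stab mul inv C.
Hypothesis fiber_x1 : forall a b, C (x1, a) -> C (x1, b) -> H (inv a ** b).
Hypothesis cV : compact V.
Hypothesis oU : open U.
Hypothesis Ux1 : U x1.
Hypothesis orbitV : forall n, U (t n x1) -> exists2 v, V v & H (inv v ** (u n x1 ** g1)).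

Let HM a b : H a -> H b -> H (a ** b).
Proof. by have [_ M _] := stab_is_subgroup C; exact: M. Qed.

Let HV a : H a -> H (inv a).
Proof. by have [_ _ M] := stab_is_subgroup C; exact: M. Qed.

Let HVM a b : H (inv a ** b) -> H (inv b ** a).
Proof. by move=> /HV; rewrite (mginvM hG) (mginvK hG). Qed.

Let fiber_mul x a b : C (x, a) -> H (inv a ** b) -> C (x, b).
Proof. by move=> Ca /stabP/(_ (x, a))[/(_ Ca)] /=; rewrite (mgKVg hG). Qed.

(** The product [V H] is closed and [U] is open, so [orbitV] passes from the orbit to its
    closure. *)
Lemma fiber_sub_compact_coset x a :
  C (x, a) -> U x -> exists2 v, V v & H (inv v ** a).
Proof.
move=> Ca Ux; apply: contrapT => na.
have cD := closed_mul_compact hG cV (closed_stab (@closed_closure _ (orbit (x1, g1)))).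
have [] := Ca (U `*` ~` [set c | exists2 v, V v & H (inv v ** c)]).
  exists (U, ~` [set c | exists2 v, V v & H (inv v ** c)]) => //; split => /=.
    exact: open_nbhs_nbhs.
  by apply: open_nbhs_nbhs; split => //; rewrite openC.
by move=> _ [[n _ <-] /= [Un]]; apply; exact: orbitV.
Qed.

(** The base points whose fibre meets the compact set [V] form a closed set. Together with the
    complement of [U] it contains the orbit of [x1], which is dense. *)
Lemma fiber_meets_compact x : U x -> exists2 v, V v & C (x, v).
Proof.
move=> Ux.
have cA : closed [set y | exists2 v, V v & C (y, v)].
  by apply: closed_proj_compact => //; exact: closed_closure.
have : [set y | exists2 v, V v & C (y, v)] `|` ~` U = setT.
  apply: (@closed_orbit_full _ x1); first by apply: closedU => //; rewrite closedC.
  move=> n; have [Un|nUn] := pselect (U (t n x1)); [left|by right].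
  have [v Vv Hv] := orbitV Un; exists v => //.
  apply: fiber_mul (HVM Hv).
  exact: (@orbit_closure_invariant _ n _ (@orbit_closure_self (x1, g1))).
by move/seteqP => [_ /(_ x I)[]].
Qed.

Lemma fiber_nonempty x : exists a, C (x, a).
Proof.
have [n Un] := meets_orbit x oU (ex_intro _ x1 Ux1).
have [v _ /(@orbit_closure_invariant _ (- n)%R _)] := fiber_meets_compact Un.
by rewrite /skew_act /= -tD addNr t0 => Cv; exists (u (- n)%R (t n x) ** v).
Qed.

(* Moving [x] along its orbit towards [x1], the two points of the fibre become
   equal modulo [H], and the obstruction [a^-1 b] only moves inside its double
   coset of [H]. *)
Lemma fiber_single_coset k x a b : lower_central mul inv one k = [set one] ->
  C (x, a) -> C (x, b) -> H (inv a ** b).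
Proof.
move=> nilk Ca Cb; set d := inv a ** b.
have sH : is_subgroup mul inv one H := stab_is_subgroup C.
apply: (nilpotent_double_coset hG (i := k) sH (closed_stab (@closed_closure _ _))).
  by rewrite nilk => _ ->; case: sH.
set HdH := [set h ** d ** l | h in H & l in H].
(* The closed relation to be transported from [x] to [x1]: two points of one fibre whose quotient
   lies in the closure of [H d H]. *)
pose D := [set q : X * (G * G) | C (q.1, q.2.1) /\ C (q.1, q.2.2) /\
  closure HdH (inv q.2.1 ** q.2.2)].
have cQ : closed [set y | exists2 p, (V `*` V) p & D (y, p)].
  apply: closed_proj_compact; first exact: compact_setX.
  have c1 : continuous (fun q : X * (G * G) => q.2.1).
    by move=> q; apply: (@continuous_comp _ _ _ snd fst); [exact: cvg_snd|exact: cvg_fst].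
  have c2 : continuous (fun q : X * (G * G) => q.2.2).
    by move=> q; apply: (@continuous_comp _ _ _ snd snd); [exact: cvg_snd|exact: cvg_snd].
  apply: closedI; [|apply: closedI]; apply: preimage_closed; try exact: closed_closure.
  - move=> q _; apply: (@cvg_pair _ _ _ (nbhs q)); [exact: cvg_fst|exact: c1].
  - move=> q _; apply: (@cvg_pair _ _ _ (nbhs q)); [exact: cvg_fst|exact: c2].
  - by move=> q _; apply: (continuous_mg hG) => //; exact: (continuous_mginv hG).
have : [set y | exists2 p, (V `*` V) p & D (y, p)] `|` ~` U = setT.
  apply: (@closed_orbit_full _ x); first by apply: closedU => //; rewrite closedC.
  move=> n; have [Un|nUn] := pselect (U (t n x)); [left|by right].
  have Cna := @orbit_closure_invariant _ n _ Ca.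
  have Cnb := @orbit_closure_invariant _ n _ Cb.
  have [v Vv Hv] := fiber_sub_compact_coset Cna Un.
  have [w Vw Hw] := fiber_sub_compact_coset Cnb Un.
  (* The moved points are replaced by representatives in [V] modulo [H]; the cocycle cancels in
     their quotient, leaving an element of [H d H]. *)
  exists (v, w) => //; split; [exact: fiber_mul Cna (HVM Hv)|split].
    exact: fiber_mul Cnb (HVM Hw).
  apply: subset_closure; exists (inv v ** (u n x ** a)) => //.
  exists (inv (u n x ** b) ** w); first exact: HVM.
  by rewrite /d (mginvM hG) !(mgA hG) !(mggK hG).
move/seteqP => [_ /(_ x1 I)[|//]] [[v w] _ [/= Cv [Cw vw]]].
by exists (inv v ** w); split => //; exact: fiber_x1.
Qed.

End OrbitClosure.

(* In a generic fibre all points have the same orbit closure, so that fibre is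
   a coset of the stabilizer of this orbit closure. *)
Lemma generic_fiber_stab (C : set (X * G)) x g a b :
  closed C -> skew_invariant C -> C (x, g) ->
  (forall g g', C (x, g) -> C (x, g') -> closure (orbit (x, g)) (x, g')) ->
  C (x, a) -> C (x, b) -> Stab mul inv (closure (orbit (x, g))) (inv a ** b).
Proof.
move=> cC iC Cg same Ca Cb; set C0 := closure _.
have [_ HM HV] := stab_is_subgroup C0.
suff gH c : C (x, c) -> Stab mul inv C0 (inv g ** c).
  have := HM _ _ (HV _ (gH a Ca)) (gH b Cb).
  by rewrite (mginvM hG) (mginvK hG) -(mgA hG) (mgKVg hG).
move=> Cc; have cC0 : closed C0 by exact: closed_closure.
have iC0 : skew_invariant C0 by exact: orbit_closure_invariant.
(* Right multiplication by [inv g ** c] sends the base point [(x, g)] to [(x, c)], which lies in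
   [C0]; hence it maps the whole orbit closure into [C0]. *)
have sub1 : C0 `<=` [set p | C0 (p.1, p.2 ** (inv g ** c))].
  apply: orbit_closure_sub; [exact: closed_rtranslate|exact: invariant_rtranslate|].
  by rewrite /= (mgKVg hG); exact: same.
have sub2 : closure (orbit (x, c)) `<=` [set p | C0 (p.1, p.2 ** (inv c ** g))].
  apply: orbit_closure_sub; [exact: closed_rtranslate|exact: invariant_rtranslate|].
  by rewrite /= (mgKVg hG); exact: orbit_closure_self.
(* Genericity from [(x, c)] back to [(x, g)] gives the inclusion for the inverse translation. *)
have sub3 : C0 `<=` [set p | C0 (p.1, p.2 ** (inv c ** g))].
  apply: subset_trans sub2; apply: orbit_closure_sub; [exact: closed_closure| |exact: same].
  exact: orbit_closure_invariant.
apply/stabP => -[y h]; split=> [/sub1//|/sub3 /=].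
by rewrite -!(mgA hG) (mgKVg hG) (mgVg hG) (mgg1 hG).
Qed.

(** Some right translate of [C0] contains the orbit closure of [p], hence [C0] itself. Evaluating
    this at [(p.1, a)] shows that the translating element stabilizes [C0], so [p] lies in [C0]. *)
Lemma orbit_closure_eq (C0 : set (X * G)) p : closed C0 -> skew_invariant C0 ->
  C0 `<=` closure (orbit p) -> (exists a, C0 (p.1, a)) ->
  (forall a b, C0 (p.1, a) -> C0 (p.1, b) -> Stab mul inv C0 (inv a ** b)) ->
  closure (orbit p) = C0.
Proof.
move=> cC0 iC0 C0p [a C0a] fiber; apply/seteqP; split => //.
have sub : closure (orbit p) `<=` [set q | C0 (q.1, q.2 ** (inv p.2 ** a))].
  apply: orbit_closure_sub; [exact: closed_rtranslate|exact: invariant_rtranslate|].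
  by rewrite /= (mgKVg hG).
have /sub/= := C0p _ C0a; move=> /(fiber _ _ C0a); rewrite (mgKg hG).
have [_ _ HV] := stab_is_subgroup C0.
move=> /HV; rewrite (mginvM hG) (mginvK hG) => /stabP/(_ (p.1, a))[/(_ C0a)] /= C0p2 _.
apply: orbit_closure_sub => //; case: p C0p2 {C0p C0a fiber sub} => x g /=.
by rewrite (mgKVg hG).
Qed.

Lemma skew_structure (C : set (X * G)) p k :
  compact [set: X] -> regular_space X ->
  @second_countable X -> hausdorff_space G -> locally_compact [set: G] ->
  @second_countable G -> lower_central mul inv one k = [set one] ->
  C = closure (orbit p) -> (forall x, exists g, C (x, g)) ->
  (forall x a b, C (x, a) -> C (x, b) -> Stab mul inv C (inv a ** b)) /\
  exists (V : set G) (U : set X), [/\ compact V, open U, U !=set0 &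
    forall x, U x -> exists2 v, V v & C (x, v)].
Proof.
move=> cX rX scX hdG lcG scG nilk CE surC.
have X0 : [set: X] !=set0 by exists p.1.
have cC : closed C by rewrite CE; exact: closed_closure.
have iC : skew_invariant C by rewrite CE; exact: orbit_closure_invariant.
have [|x1 [lsc same]] := generic_point cX rX X0 scX hdG lcG scG cC.
  by rewrite CE; exact: orbit_closure_transitive.
have [g1 Cg1] := surC x1.
have [W g1W [cW _]] := locally_compact_nbhs hdG lcG (@filterT _ (nbhs g1) _).
pose U := [set y | exists2 v, W v & C (y, v)]°.
have oU : open U by exact: open_interior.
have Ux1 : U x1 by exact: lsc Cg1 g1W.
set C0 := closure (orbit (x1, g1)).
have C0C : C0 `<=` C by exact: orbit_closure_sub.
have cC0 : closed C0 by exact: closed_closure.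
have iC0 : skew_invariant C0 by exact: orbit_closure_invariant.
have stabC a b : C (x1, a) -> C (x1, b) -> Stab mul inv C0 (inv a ** b).
  exact: generic_fiber_stab.
have fiber_x1 a b : C0 (x1, a) -> C0 (x1, b) -> Stab mul inv C0 (inv a ** b).
  by move=> /C0C Ca /C0C; exact: stabC.
(* A point [v] of [C] above [t n x1] is pulled back to the fibre above [x1], where any two points of
   [C] agree modulo the stabilizer of [C0]. *)
have orbitV n : U (t n x1) ->
    exists2 v, closure W v & Stab mul inv C0 (inv v ** (u n x1 ** g1)).
  move=> /interior_subset[v Wv Cv]; exists v; first exact: subset_closure.
  have := iC (- n)%R _ Cv; rewrite /skew_act /= -tD addNr t0 => Cv'.
  have := stabC _ _ Cv' Cg1.
  have := uD (- n)%R n x1; rewrite addNr u0 => /esym/(mginv_uniq hG) ->.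
  by rewrite (mginvM hG) -(mgA hG).
have C0E : closure (orbit p) = C0.
  apply: orbit_closure_eq => //; first by rewrite -CE.
    exact: (fiber_nonempty cW oU Ux1 orbitV).
  by move=> a b; exact: (fiber_single_coset fiber_x1 cW oU Ux1 orbitV nilk).
rewrite CE C0E; split.
  by move=> x a b; exact: (fiber_single_coset fiber_x1 cW oU Ux1 orbitV nilk).
exists (closure W), U; split => //; first by exists x1.
exact: (fiber_meets_compact cW oU orbitV).
Qed.

(** A fibre lies in one coset and [O] is saturated, so a fibre that meets [O] is contained in [O].
    After moving [x] into [U], missing [O] can be tested on representatives in the compact set [V],
    which makes it a closed condition nearby. *)
Lemma open_fiber_meets (C : set (X * G)) (V O : set G) (U : set X) :
  closed C -> skew_invariant C ->
  (forall x a b, C (x, a) -> C (x, b) -> Stab mul inv C (inv a ** b)) ->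
  compact V -> open U -> U !=set0 -> (forall x, U x -> exists2 v, V v & C (x, v)) ->
  open O -> (forall a h, O a -> Stab mul inv C h -> O (a ** h)) ->
  open [set x | exists2 g, C (x, g) & O g].
Proof.
move=> cC iC fib cV oU U0 UV oO OH; rewrite openE => x [g Cg Og].
have [n Un] := meets_orbit x oU U0.
have back y v : C (t n y, v) -> C (y, u (- n)%R (t n y) ** v).
  by move=> /(iC (- n)%R); rewrite /skew_act /= -tD addNr t0.
have cW : continuous (fun p : X * G => u (- n)%R (t n p.1) ** p.2).
  apply: (continuous_mg hG) => q; last exact: cvg_snd.
  apply: (@continuous_comp _ _ _ (t n \o fst) (u (- n)%R)); last exact: cu.
  by apply: (@continuous_comp _ _ _ fst (t n)); [exact: cvg_fst|exact: ct].
(* Pairs [(y, v)] with [v] in the fibre above [t n y] whose pullback to the fibre above [y] misses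
   [O]. *)
pose D := (fun p : X * G => (t n p.1, p.2)) @^-1` C `&`
  (fun p : X * G => u (- n)%R (t n p.1) ** p.2) @^-1` (~` O).
have cB : closed [set y | exists2 v, V v & D (y, v)].
  apply: closed_proj_compact => //.
  apply: closedI; apply: preimage_closed => //; last by rewrite closedC.
  move=> q _; apply: (@cvg_pair _ _ _ (nbhs q)); last exact: cvg_snd.
  by apply: (@continuous_comp _ _ _ fst (t n)); [exact: cvg_fst|exact: ct].
have n1 : nbhs x (t n @^-1` U) by apply: ct; exact: open_nbhs_nbhs.
have n2 : nbhs x (~` [set y | exists2 v, V v & D (y, v)]).
  apply: open_nbhs_nbhs; split; first by rewrite openC.
  move=> [v _ [/= /back Cv]]; apply.
  by rewrite -(mgKVg hG g (_ ** _)); exact: OH Og (fib _ _ _ Cg Cv).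
apply: filterS (filterI n1 n2) => y [/UV[v Vv Cv] nB].
exists (u (- n)%R (t n y) ** v); first exact: back.
by apply: contrapT => nO; apply: nB; exists v.
Qed.

End SkewProduct.

(** * Iterates and cocycles *)

Section Iterates.
Variables (X : Type) (T Tinv : X -> X).
Hypothesis TK : cancel T Tinv.
Hypothesis TVK : cancel Tinv T.
Local Notation t := (Tpow T Tinv).

Let TpowS n x : t (n + 1)%R x = T (t n x).
Proof.
case: n => [k|[|k]]; first by rewrite -PoszD addn1.
  by rewrite /= TVK.
have -> : (Negz k.+1 + 1)%R = Negz k by rewrite !NegzE -addn1 PoszD opprD addrNK.
by rewrite /= TVK.
Qed.

Let TpowB n x : t (n - 1)%R x = Tinv (t n x).
Proof. by rewrite -[in RHS](subrK 1%R n) TpowS TK. Qed.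

Lemma Tpow_add m n x : t (m + n)%R x = t m (t n x).
Proof.
elim: m => [|m IH|m IH]; first by rewrite add0r.
  by rewrite -addn1 PoszD -addrA [(1 + n)%R]addrC addrA !TpowS IH.
by rewrite -addn1 PoszD opprD -addrA [(- 1 + n)%R]addrC addrA !TpowB IH.
Qed.

End Iterates.

Section Cocycle.
Variables (G : topologicalType) (mul : G -> G -> G) (inv : G -> G) (one : G).
Hypothesis hG : topological_group mul inv one.
Variables (X : topologicalType) (T Tinv : X -> X) (f : X -> G).
Hypothesis hT : homeomorphism T Tinv.
Hypothesis cf : continuous f.
Local Notation "a ** b" := (mul a b) (at level 40, left associativity).
Local Notation t := (Tpow T Tinv).
Local Notation u := (cocycle mul inv one T Tinv f).

(** The skew product is itself an invertible map, so the cocycle identity can be read off from the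
    additivity of its powers. *)
Let S (p : X * G) : X * G := (T p.1, f p.1 ** p.2).
Let Sinv (p : X * G) : X * G := (Tinv p.1, inv (f (Tinv p.1)) ** p.2).

Let SK : cancel S Sinv.
Proof. by case: hT => TK _ _ _ [x g]; rewrite /S /Sinv /= TK (mgKg hG). Qed.

Let SVK : cancel Sinv S.
Proof. by case: hT => _ TVK _ _ [x g]; rewrite /S /Sinv /= TVK (mgKVg hG). Qed.

Let Tpow_skew n x g : Tpow S Sinv n (x, g) = (t n x, u n x ** g).
Proof.
have pos k y h : Tpow S Sinv (Posz k) (y, h) = (t k y, u k y ** h).
  elim: k => [|k IH]; first by rewrite /= (mg1g hG).
  by move: IH => /= ->; rewrite /S /= (mgA hG).
case: n => [k|k]; first exact: pos.
have [TK TVK _ _] := hT.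
have eN : (Posz k.+1 + Negz k = 0)%R by rewrite NegzE addrN.
(* For a negative time, advancing the claimed value by [k.+1] positive steps returns [(x, g)];
   applying the negative power then gives the formula. *)
have := pos k.+1 (t (Negz k) x) (u (Negz k) x ** g).
rewrite -(Tpow_add TK TVK) eN /= (mgKVg hG) => <-.
by apply: etrans (esym (Tpow_add SK SVK (Negz k) k.+1 _)) _; rewrite addrC eN.
Qed.

Lemma cocycle_add m n x : u (m + n)%R x = u m (t n x) ** u n x.
Proof.
have := Tpow_add SK SVK m n (x, one).
by rewrite !Tpow_skew !(mgg1 hG) => -[].
Qed.

Lemma continuous_Tpow n : continuous (t n).
Proof.
have [_ _ cT cTinv] := hT.
have iterc (h : X -> X) k : continuous h -> continuous (iter k h).
  move=> ch; elim: k => [|k IH] x; first exact: cvg_id.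
  by apply: (@continuous_comp _ _ _ (iter k h) h); [exact: IH|exact: ch].
by case: n => k; exact: iterc.
Qed.

Lemma continuous_cocycle n : continuous (u n).
Proof.
have cnat k : continuous (cocycle_nat mul one T f k).
  elim: k => [|k IH] /=; first by move=> x; exact: cvg_cst.
  apply: (continuous_mg hG) => // x.
  by apply: (@continuous_comp _ _ _ (iter k T) f); [exact: (@continuous_Tpow k)|exact: cf].
case: n => k; first exact: cnat.
apply: (continuous_mginv hG) => x.
apply: (@continuous_comp _ _ _ (t (Negz k)) (cocycle_nat mul one T f k.+1)).
  exact: continuous_Tpow.
exact: cnat.
Qed.

End Cocycle.

(** * Fibres as cosets and continuity of the coset map *)

Lemma lcoset_eq (G : topologicalType) mul inv one (H : set G) a b :
  @topological_group G mul inv one -> is_subgroup mul inv one H ->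
  H (mul (inv a) b) -> lcoset mul a H = lcoset mul b H.
Proof.
move=> hG [_ HM HV] Hab; apply/seteqP; split=> _ [h Hh <-].
  exists (mul (mul (inv b) a) h); last by rewrite -(mgA hG) (mgKVg hG).
  by apply: (HM _ _ _ Hh); have := HV _ Hab; rewrite (mginvM hG) (mginvK hG).
exists (mul (mul (inv a) b) h); last by rewrite -(mgA hG) (mgKVg hG).
exact: HM.
Qed.

Unset Implicit Arguments.

Theorem theorem3p2 (R : realType) (X : metricType R) (T Tinv : X -> X)
  (G : topologicalType) (mul : G -> G -> G) (inv : G -> G) (one : G)
  (f : X -> G) (C : set (X * G)) :
  compact [set: X] ->
  homeomorphism T Tinv ->
  minimal_map T ->
  topological_group mul inv one ->
  hausdorff_space G ->
  locally_compact [set: G] ->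
  @second_countable G ->
  nilpotent_group mul inv one ->
  continuous f ->
  regular_cocycle mul inv one T Tinv f ->
  surj_orbit_closure mul inv one T Tinv f C ->
  let H := Stab mul inv C in
  (forall x : X, exists gx : G, fiber C x = lcoset mul gx H) /\
  (forall gx : X -> G, (forall x, fiber C x = lcoset mul (gx x) H) ->
     continuous_to_quotient mul H (fun x => lcoset mul (gx x) H)).
Proof.
move=> cX hT minT hG hdG lcG scG [k nilk] cf _ [p [CE surC]] H.
have [TK TVK _ _] := hT.
pose t := Tpow T Tinv; pose u := cocycle mul inv one T Tinv f.
have t0 x : t 0%R x = x by [].
have u0 x : u 0%R x = one by [].
have tD : forall m n x, t (m + n)%R x = t m (t n x) := Tpow_add TK TVK.
have uD : forall m n x, u (m + n)%R x = mul (u m (t n x)) (u n x) :=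
  cocycle_add hG f hT.
have ct : forall n, continuous (t n) := continuous_Tpow hT.
have cu : forall n, continuous (u n) := continuous_cocycle hG hT cf.
(* Invariance under times [1] and [-1] gives the equality of [A] with its image that [minimal_map]
   asks for. *)
have minX (A : set X) : closed A -> A !=set0 ->
    (forall n x, A x -> A (t n x)) -> A = setT.
  move=> cA A0 iA; apply: minT => //; apply/seteqP; split=> [_ [x Ax <-]|x Ax].
    exact: (iA 1%R).
  by exists (Tinv x); [exact: (iA (Negz 0))|exact: TVK].
have fibC x : exists g, C (x, g).
  by have : [set: X] x by []; rewrite -surC => -[[y g] Cy /= <-]; exists g.
have [fib [V [U [cV oU U0 UV]]]] := skew_structure hG t0 tD u0 uD ct cu minX cX
  (@uniform_regular X) (compact_metric_second_countable cX (ex_intro _ p.1 I))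
  hdG lcG scG nilk CE fibC.
have cC : closed C by rewrite CE; exact: closed_closure.
have iC : skew_invariant mul t u C.
  by rewrite CE; exact: (orbit_closure_invariant hG tD uD ct cu).
have sH : is_subgroup mul inv one H := stab_is_subgroup hG C.
have [H1 HM HV] := sH.
have CH x g h : C (x, g) -> H h -> C (x, mul g h).
  by move=> Cg /(stabP hG)/(_ (x, g))[/(_ Cg)].
split=> [x|gx fibE W WH oW].
  have [g Cg] := fibC x; exists g; apply/seteqP; split=> [b Cb|_ [h Hh <-]].
    by exists (mul (inv g) b); [exact: fib Cg Cb|rewrite (mgKVg hG)].
  exact: CH.
have WE c g : W c -> c g -> c = lcoset mul g H.
  move=> /WH[b _ <-] [h Hh <-]; apply: (lcoset_eq hG sH).
  by rewrite (mgKg hG).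
have Cgx x : C (x, gx x).
  have : lcoset mul (gx x) H (gx x) by exists one => //; rewrite (mgg1 hG).
  by rewrite -fibE.
(* Since the fibre above [x] is the coset of [gx x], that coset belongs to [W] exactly when the
   fibre meets the union of [W], a saturated open set. *)
suff -> : (fun x => lcoset mul (gx x) H) @^-1` W =
    [set x | exists2 g, C (x, g) & (\bigcup_(c in W) c) g].
  apply: (open_fiber_meets hG t0 tD ct cu minX cC iC fib cV oU U0 UV oW).
  move=> a h [c Wc ca] Hh; exists c => //.
  by rewrite (WE c a Wc ca); exists h.
apply/seteqP; split=> [x Wx|x [g Cg [c Wc cg]]].
  by exists (gx x) => //; exists (lcoset mul (gx x) H) => //; exists one => //; rewrite (mgg1 hG).
rewrite /= (lcoset_eq hG sH (fib _ _ _ (Cgx x) Cg)).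
by rewrite -(WE c g Wc cg).
Qed.
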